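(* Let $A\subset\mathbb{R}^2$ be a non-empty perfect set. Then there exists a compact set $E\subset\mathbb{R}^2$ of two-dimensional Lebesgue measure zero that contains, in every direction, a unit line segment whose center lies in $A$; that is, for every $e\in S^1$ there exists $a\in A$ such that $\{a+te : t\in[-\tfrac12,\tfrac12]\}\subset E$.
   Context: A subset of $\mathbb{R}^d$ is called perfect if it is closed and has no isolated points. A unit line segment in direction $e\in S^1$ (the unit circle in $\mathbb{R}^2$) with center $a\in\mathbb{R}^2$ is the closed segment $\{a+te : t\in[-\tfrac12,\tfrac12]\}$ of length $1$. *)

(* Defs.v *)
From HB Require Import structures.
From mathcomp Require Import all_boot all_order all_algebra.
From mathcomp Require Import all_classical all_reals all_analysis.
Set Implicit Arguments.
Unset Strict Implicit.
Unset Printing Implicit Defensive.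
Import Order.TTheory GRing.Theory Num.Theory.
Import numFieldNormedType.Exports.
Local Open Scope classical_set_scope.
Local Open Scope ring_scope.

(* The plane is [R * R]. Its canonical norm is the sup norm, which gives the
   usual topology but not the Euclidean length; hence the explicit equation. *)
Definition unit_circle (R : realType) : set (R * R) :=
  [set e | e.1 ^+ 2 + e.2 ^+ 2 = 1].
Arguments unit_circle R : clear implicits.

Definition unit_segment (R : realType) (a e : R * R) : set (R * R) :=
  [set a + t *: e | t in `[- 2^-1, 2^-1]].

(* The product measure is computed by sections on every set, but is meaningful
   only on the product sigma-algebra, which contains all compact sets. *)
Definition lebesgue_measure2 (R : realType) : set (R * R) -> \bar R :=
  (@lebesgue_measure R \x @lebesgue_measure R)%E.

(* Main.v *)
Require Import Defs.
From HB Require Import structures.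
From mathcomp Require Import all_boot all_order all_algebra.
From mathcomp Require Import all_classical all_reals all_analysis.
From mathcomp Require Import measurable_realfun lra ring.
Import Order.TTheory GRing.Theory Num.Theory.
Import numFieldNormedType.Exports.
Local Open Scope classical_set_scope.
Local Open Scope ring_scope.

(** Consider directions [(1, m)] with [|m| <= 1]; the others follow by swapping the
    coordinates.  The lines through [a] with slopes in an interval form a sector, and
    it suffices to replace every sector by finitely many sectors with nearby centers
    in [A], together covering the same slopes, so that the total area becomes
    arbitrarily small: iterating this and passing to the limit gives a compact null
    set.

    Say that the factor [rho] is attainable if, for every content [f] dominated by
    area, a sector [S] can be replaced by a set of content at most [rho f(S) + eps].
    If [rho] is attainable, so is [rho - rho^2/4].  Choose [b] in [A] very close to
    [a], cut the slopes into very small cells, and toss a fair coin for each cell to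
    decide whether it stays at [a] or moves to [b].  Let [R0] and [R1] be the unions
    of the sectors kept at [a] and moved to [b].  Almost every point of [S] lies in
    both with probability 1/4, since its slopes from [a] and [b] are in different
    cells; hence some outcome has
    [f(R0) + f(R1) - rho f(R0 & R1) <= (1 - rho/4) f(S) + eps].  Replace [R0] by a
    set [U0] using the content [f - rho f(. & R1)], then [R1] by [U1] using the
    content [f] outside [U0]; this gives
    [f(U0 | U1) <= rho (f(R0) + f(R1) - rho f(R0 & R1)) + eps].  No independence
    between the successive generations is needed because [f] is arbitrary. *)

Set Implicit Arguments.
Unset Strict Implicit.
Unset Printing Implicit Defensive.

(** * Area in the plane *)

Section area.
Context {R : realType}.
Implicit Types (X Y : set (R * R)) (p : R * R).
Local Notation lam := (@lebesgue_measure2 R).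
Local Notation leb := (@lebesgue_measure R).

(** Tonelli: each vertical section lies in an interval of length [2 * w2]. As [phi] enters only
    through its value on each vertical line, it may be an arbitrary function. *)
Lemma area_le_slab X (phi : R -> R) (s w1 w2 : R) : measurable X ->
  0 <= w1 -> 0 <= w2 ->
  (forall p, X p -> s <= p.1 <= s + w1 /\ `|p.2 - phi p.1| <= w2) ->
  (lam X <= (w1 * (2 * w2))%:E)%E.
Proof.
move=> mX w10 w20 Xsub.
have le_sec x : (leb (xsection X x) <= (2 * w2 * \1_`[s, s + w1] x)%:E)%E.
  have [xin|xout] := boolP (x \in `[s, s + w1]).
    rewrite indicE mem_set ?mulr1//.
    apply: (@le_trans _ _ (leb `[phi x - w2, phi x + w2])).
      apply: le_measure; rewrite ?inE//; first exact: measurable_xsection.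
      move=> y; rewrite /xsection/= inE => /Xsub[_] /=.
      by rewrite ler_norml in_itv/= => /andP[]; lra.
    rewrite lebesgue_measure_itv/= lte_fin.
    by case: ifP => // _; rewrite ?lee_fin -?EFinB ?lee_fin; lra.
  rewrite (_ : xsection X x = set0) ?measure0 ?lee_fin ?mulr_ge0//.
  rewrite -subset0 => y; rewrite /xsection/= inE => /Xsub[/= xin _].
  by move: xout; rewrite in_itv/= xin.
rewrite /lebesgue_measure2 /product_measure1.
apply: (@le_trans _ _ (\int[leb]_x (2 * w2 * \1_`[s, s + w1] x)%:E)%E).
  apply: ge0_le_integral => //.
  - exact: measurable_fun_xsection.
  - by apply/measurable_EFinP; apply: measurable_funM.
  - by move=> x _; exact: le_sec.
under eq_integral do rewrite EFinM.
rewrite ge0_integralZl_EFin ?mulr_ge0//; last exact/measurable_EFinP.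
rewrite integral_indic// setIT /= lebesgue_measure_itv/= lte_fin.
by case: ifP => _; rewrite ?mule0 ?lee_fin -?EFinB -?EFinM ?lee_fin; nra.
Qed.

Definition swap_set (X : set (R * R)) : set (R * R) := [set p | X (p.2, p.1)].

Lemma measurable_swap_set X : measurable X -> measurable (swap_set X).
Proof.
by move=> mX; rewrite -[swap_set X]setTI; exact: measurable_swap measurableT _ mX.
Qed.

(** Swapping turns horizontal sections into vertical ones, and the two iterated integrals define the
    same measure by uniqueness of the product measure. *)
Lemma area_swap X : measurable X -> lam (swap_set X) = lam X.
Proof.
move=> mX; rewrite /lebesgue_measure2.
transitivity ((leb \x^ leb)%E X); last first.
  apply/esym/(@product_measure_unique _ _ (measurableTypeR R) (measurableTypeR R)
    R leb leb (leb \x^ leb)%E) => // A B mA mB.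
  exact: (product_measure2E leb leb).
rewrite /product_measure1 /product_measure2; apply: eq_integral => x _ /=.
by congr (leb _); apply/seteqP; split => y /=; rewrite /xsection/ysection/= !inE.
Qed.

End area.

(** * Contents dominated by area *)

Section contents.
Context {R : realType}.
Implicit Types (X Y Z : set (R * R)) (p a : R * R) (f : set (R * R) -> R).
Local Notation lam := (@lebesgue_measure2 R).

(** A window that makes areas finite. Its half-width leaves room for centers moving by 1/2 and
    segments reaching 1/2 further. *)
Definition box a : set (R * R) :=
  [set p | `|p.1 - a.1| <= 2 /\ `|p.2 - a.2| <= 2].

Lemma measurable_le_fun (g h : R * R -> R) :
  measurable_fun setT g -> measurable_fun setT h ->
  measurable [set p | g p <= h p].
Proof. by move=> mg mh; rewrite -[X in measurable X]setTI; exact: measurable_fun_le. Qed.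

Lemma measurable_box a : measurable (box a).
Proof.
apply: measurableI; apply: measurable_le_fun => //.
- by apply: measurableT_comp => //; apply: measurable_funB => //.
- by apply: measurableT_comp => //; apply: measurable_funB => //.
Qed.
#[local] Hint Resolve measurable_box : core.

Variable a0 : R * R.

Definition vol X : R := fine (lam (X `&` box a0)).

Lemma area_box_slab X (phi : R -> R) w : measurable X -> 0 <= w ->
  (forall p, X p -> box a0 p -> `|p.2 - phi p.1| <= w) ->
  (lam (X `&` box a0) <= (8 * w)%:E)%E.
Proof.
move=> mX w0 Xw; rewrite (_ : 8 * w = 4 * (2 * w)); last by ring.
apply: (@area_le_slab R _ phi (a0.1 - 2)) => //; first exact: measurableI.
move=> p [Xp bp]; split; last exact: Xw.
by case: bp; rewrite ler_norml => /andP[? ?] _; apply/andP; split; lra.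
Qed.

Lemma area_box_vslab X s w : measurable X -> 0 <= w ->
  (forall p, X p -> box a0 p -> `|p.1 - s| <= w) ->
  (lam (X `&` box a0) <= (8 * w)%:E)%E.
Proof.
move=> mX w0 Xw; rewrite (_ : 8 * w = (2 * w) * (2 * 2)); last by ring.
apply: (@area_le_slab R _ (fun=> a0.2) (s - w)) => //.
- exact: measurableI.
- by rewrite mulr_ge0.
move=> p [Xp bp]; split; last by case: bp.
by have := Xw _ Xp bp; rewrite ler_norml => /andP[? ?]; apply/andP; split; lra.
Qed.

Lemma volE X : measurable X -> (vol X)%:E = lam (X `&` box a0).
Proof.
move=> mX; rewrite /vol fineK// ge0_fin_numE; last exact: measure_ge0.
apply: le_lt_trans (ltry (8 * 2)).
by apply: (@area_box_slab _ (fun=> a0.2)) => // p _ [].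
Qed.

Lemma vol_slab X (phi : R -> R) w : measurable X -> 0 <= w ->
  (forall p, X p -> box a0 p -> `|p.2 - phi p.1| <= w) -> vol X <= 8 * w.
Proof. by move=> mX w0 Xw; rewrite -lee_fin volE//; exact: area_box_slab Xw. Qed.

Lemma vol_vslab X s w : measurable X -> 0 <= w ->
  (forall p, X p -> box a0 p -> `|p.1 - s| <= w) -> vol X <= 8 * w.
Proof. by move=> mX w0 Xw; rewrite -lee_fin volE//; exact: area_box_vslab Xw. Qed.

(** Finite additivity suffices because only finite unions are measured, and the class is stable
    under restriction and reweighting. *)
Definition content f :=
  (forall X Y, measurable X -> measurable Y -> X `&` Y = set0 ->
     f (X `|` Y) = f X + f Y) /\
  (forall X, measurable X -> 0 <= f X <= vol X).

Lemma content_vol : content vol.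
Proof.
split=> [X Y mX mY XY|X mX]; last by rewrite fine_ge0/=.
apply: EFin_inj; rewrite EFinD (volE mX) (volE mY) (volE (measurableU _ _ mX mY)).
rewrite setIUl /lebesgue_measure2 measureU//.
- exact: (measurableI _ _ mX (measurable_box a0)).
- exact: (measurableI _ _ mY (measurable_box a0)).
by rewrite setIACA XY set0I.
Qed.

Section content_theory.
Variable f : set (R * R) -> R.
Hypothesis cf : content f.

Lemma content_ge0 X : measurable X -> 0 <= f X.
Proof. by move=> mX; have /andP[] := cf.2 _ mX. Qed.

Lemma content_le_vol X : measurable X -> f X <= vol X.
Proof. by move=> mX; have /andP[] := cf.2 _ mX. Qed.

Lemma content0 : f set0 = 0.
Proof.
have := cf.1 set0 set0 measurable0 measurable0 (set0I _).
by rewrite setU0; lra.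
Qed.

Lemma content_split X Y : measurable X -> measurable Y ->
  f X = f (X `&` Y) + f (X `\` Y).
Proof.
move=> mX mY; rewrite -cf.1; first by rewrite setUIDK.
- exact: measurableI.
- exact: measurableD.
- by rewrite setDE setIACA setICr setI0.
Qed.

Lemma content_le X Y : measurable X -> measurable Y -> X `<=` Y -> f X <= f Y.
Proof.
move=> mX mY XY; rewrite (content_split mY mX) setIC (setIidl XY).
by rewrite lerDl content_ge0//; exact: measurableD.
Qed.

Lemma contentU_split X Y : measurable X -> measurable Y ->
  f (X `|` Y) = f X + f (Y `\` X).
Proof.
move=> mX mY; rewrite -cf.1//; last 2 first.
- exact: measurableD.
- by rewrite setDIK.
congr f; apply/seteqP; split=> p; last by case=> [|[]]; [left|right].
by case=> [|Yp]; [left|have [|] := pselect (X p); [left|right]].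
Qed.

Lemma contentU_le X Y : measurable X -> measurable Y -> f (X `|` Y) <= f X + f Y.
Proof.
move=> mX mY; rewrite contentU_split// lerD2l.
by apply: content_le => //; exact: measurableD.
Qed.

Lemma content_bigU (I : eqType) (r : seq I) (P : pred I) (F : I -> set (R * R)) :
  uniq r -> (forall i, measurable (F i)) ->
  (forall i j, i != j -> F i `&` F j = set0) ->
  f (\big[setU/set0]_(i <- r | P i) F i) = \sum_(i <- r | P i) f (F i).
Proof.
move=> + mF dF; elim: r => [|i r IH]/=; first by rewrite !big_nil content0.
move=> /andP[ir ur]; rewrite !big_cons; case: ifPn => Pi; last exact: IH.
rewrite cf.1 ?IH//; first exact: bigsetU_measurable.
rewrite big_distrr/= big_seq_cond big1// => j /andP[jr _]; apply: dF.
by apply: contraNneq ir => ->.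
Qed.

Lemma content_bigUI (I : eqType) (r : seq I) (P : pred I) (F : I -> set (R * R))
    Z : uniq r -> (forall i, measurable (F i)) -> measurable Z ->
  (forall i j, i != j -> F i `&` F j = set0) ->
  f ((\big[setU/set0]_(i <- r | P i) F i) `&` Z) =
  \sum_(i <- r | P i) f (F i `&` Z).
Proof.
move=> ur mF mZ dF; rewrite big_distrl/= content_bigU//.
- by move=> i; exact: measurableI.
- by move=> i j ij; rewrite setIACA dF// set0I.
Qed.

Lemma content_setD X : measurable X -> content (fun Y => f (Y `\` X)).
Proof.
move=> mX; split=> [Y Z mY mZ YZ|Y mY].
  rewrite setDUl cf.1//; try exact: measurableD.
  by rewrite !setDE setIACA YZ set0I.
apply/andP; split; first by apply: content_ge0; exact: measurableD.
apply: le_trans (content_le_vol mY).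
by apply: content_le => //; exact: measurableD.
Qed.

(** The weight is 1 off [X] and [1 - rho] on [X], hence lies between 0 and 1. *)
Lemma content_reweight (rho : R) X : 0 <= rho <= 1 -> measurable X ->
  content (fun Y => f Y - rho * f (Y `&` X)).
Proof.
move=> /andP[rho0 rho1] mX; split=> [Y Z mY mZ YZ|Y mY].
  rewrite setIUl !cf.1//; try exact: measurableI; first by ring.
  by rewrite setIACA YZ set0I.
have mYX : measurable (Y `&` X) by exact: measurableI.
have le1 : f (Y `&` X) <= f Y by exact: content_le.
have := content_ge0 mYX; have := content_le_vol mY => ? ?.
by apply/andP; split; nra.
Qed.

End content_theory.
End contents.

(** * Coin flips *)

Section coin_flips.
Context {R : realType} {n : nat}.
Local Notation G := {ffun 'I_n -> bool}.
Implicit Type g : G.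

Definition flip (k : 'I_n) g : {ffun 'I_n -> bool} :=
  [ffun j => if j == k then ~~ g j else g j].

Lemma flipK k : involutive (flip k).
Proof. by move=> g; apply/ffunP => j; rewrite !ffunE; case: eqP; rewrite ?negbK. Qed.

(** Flipping coin [k] is an involution of the outcomes that exchanges its two faces and preserves
    [h], so both faces contribute equally. *)
Lemma sum_coin k (h : {ffun 'I_n -> bool} -> R) : (forall g, h (flip k g) = h g) ->
  \sum_(g : G) (g k)%:R * h g = 2^-1 * \sum_(g : G) h g.
Proof.
move=> hk.
have E : \sum_(g : G) (g k)%:R * h g = \sum_(g : G) (1 - (g k)%:R) * h g.
  rewrite (reindex_inj (inv_inj (flipK k))); apply: eq_bigr => g _.
  by rewrite hk ffunE eqxx; case: (g k); rewrite /= ?subr0 ?subrr.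
have : \sum_(g : G) (g k)%:R * h g + \sum_(g : G) (1 - (g k)%:R) * h g = \sum_(g : G) h g.
  by rewrite -big_split; apply: eq_bigr => g _ /=; ring.
by rewrite -E; lra.
Qed.

Lemma sum_coinN k (h : {ffun 'I_n -> bool} -> R) : (forall g, h (flip k g) = h g) ->
  \sum_(g : G) (~~ g k)%:R * h g = 2^-1 * \sum_(g : G) h g.
Proof.
move=> hk; have := sum_coin hk.
have : \sum_(g : G) (g k)%:R * h g + \sum_(g : G) (~~ g k)%:R * h g = \sum_(g : G) h g.
  rewrite -big_split; apply: eq_bigr => g _ /=.
  by case: (g k); rewrite /= ?mul1r ?mul0r ?add0r ?addr0.
by move=> <-; lra.
Qed.

(** The right side is the average of the left: each single term survives with probability 1/2, each
    pair with [l != k] with probability 1/4, and a pair with [l = k] never. Some outcome does not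
    exceed the average. *)
Lemma exists_coins (u v : 'I_n -> R) (w : 'I_n -> 'I_n -> R) (rho : R) :
  exists g, \sum_(k | g k) u k + \sum_(l | ~~ g l) v l
     - rho * (\sum_(k | g k) \sum_(l | ~~ g l) w k l)
  <= 2^-1 * \sum_k u k + 2^-1 * \sum_l v l
     - rho / 4 * (\sum_k \sum_(l | l != k) w k l).
Proof.
pose rhs := 2^-1 * \sum_k u k + 2^-1 * \sum_l v l
  - rho / 4 * (\sum_k \sum_(l | l != k) w k l).
(* [N] is the number of outcomes. *)
pose N : R := \sum_(g : {ffun 'I_n -> bool}) 1.
pose S0 g := \sum_(k | g k) u k; pose S1 g := \sum_(l | ~~ g l) v l.
pose S2 g := \sum_(k | g k) \sum_(l | ~~ g l) w k l.
have E0 : \sum_(g : G) S0 g = N * (2^-1 * \sum_k u k).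
  under eq_bigr do rewrite /S0 big_mkcond.
  rewrite exchange_big/= mulr_sumr mulr_sumr; apply: eq_bigr => k _.
  rewrite (eq_bigr (fun g => (g k)%:R * u k)); last first.
    by move=> g _; case: (g k); rewrite ?mul1r ?mul0r.
  rewrite (@sum_coin k (fun=> u k))// (_ : \sum_(g : G) u k = N * u k); first by ring.
  by rewrite /N mulr_suml; under [RHS]eq_bigr do rewrite mul1r.
have E1 : \sum_(g : G) S1 g = N * (2^-1 * \sum_k v k).
  under eq_bigr do rewrite /S1 big_mkcond.
  rewrite exchange_big/= mulr_sumr mulr_sumr; apply: eq_bigr => k _.
  rewrite (eq_bigr (fun g => (~~ g k)%:R * v k)); last first.
    by move=> g _; case: (g k); rewrite ?mul1r ?mul0r.
  rewrite (@sum_coinN k (fun=> v k))// (_ : \sum_(g : G) v k = N * v k); first by ring.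
  by rewrite /N mulr_suml; under [RHS]eq_bigr do rewrite mul1r.
have E2 : \sum_(g : G) S2 g = N * (4^-1 * \sum_k \sum_(l | l != k) w k l).
  rewrite (eq_bigr (fun g => \sum_k \sum_(l | l != k)
      (g k)%:R * ((~~ g l)%:R * w k l))); last first.
    move=> g _; rewrite /S2 big_mkcond; apply: eq_bigr => k _.
    case: ifPn => gk; last first.
      by rewrite big1// => l _; rewrite mul0r.
    under [RHS]eq_bigr do rewrite mul1r.
    rewrite big_mkcond [RHS]big_mkcond; apply: eq_bigr => l _.
    have [->|lk] := eqVneq l k; first by rewrite gk.
    by case: (g l); rewrite ?mul1r ?mul0r.
  rewrite exchange_big/= !mulr_sumr; apply: eq_bigr => k _.
  rewrite exchange_big/= !mulr_sumr; apply: eq_bigr => l lk.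
  rewrite (@sum_coin k (fun g => (~~ g l)%:R * w k l)); last first.
    by move=> g; rewrite ffunE (negPf lk).
  rewrite (@sum_coinN l (fun=> w k l))//.
  rewrite (_ : \sum_(g : G) w k l = N * w k l); last first.
    by rewrite /N mulr_suml; under [RHS]eq_bigr do rewrite mul1r.
  have -> : (4^-1 : R) = 2^-1 * 2^-1 by field.
  by ring.
apply: contrapT => /forallNP Phin.
have N0 : 0 < N.
  rewrite /N (bigD1 [ffun=> true])//= ltr_pwDl// sumr_ge0//.
have : \sum_(g : G) rhs < \sum_(g : G) (S0 g + S1 g - rho * S2 g).
  rewrite (bigD1 [ffun=> true])//= [ltRHS](bigD1 [ffun=> true])//=.
  rewrite ltr_leD//; first by rewrite ltNge; apply/negP; exact: Phin.
  by apply: ler_sum => g _; apply/ltW; rewrite ltNge; apply/negP; exact: Phin.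
rewrite ltNge => /negP; apply.
rewrite big_split/= big_split/= E0 E1 sumrN -mulr_sumr E2.
rewrite (_ : \sum_(g : G) rhs = N * rhs); last first.
  by rewrite /N mulr_suml; under [RHS]eq_bigr do rewrite mul1r.
by rewrite /rhs; lra.
Qed.

End coin_flips.

(** * Sectors *)

Section sectors.
Context {R : realType}.
Implicit Types (p a b : R * R) (s t : (R * R) * (R * R)).

Definition slope a p : R := (p.2 - a.2) / (p.1 - a.1).

(** A piece is an apex [s.1] with two end slopes [s.2]. The range is half-open so that adjacent
    cells are disjoint. *)
Definition slopes s : set R := [set m | s.2.1 <= m < s.2.2].

(** A two-sided sector. The vertical line through the apex is excluded, since there the division in
    [slope] takes its default value 0. *)
Definition sector s : set (R * R) :=
  [set p | p.1 != s.1.1 /\ slopes s (slope s.1 p)].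

Lemma slopeE a p : p.1 != a.1 -> p.2 - a.2 = slope a p * (p.1 - a.1).
Proof. by move=> pa; rewrite divfK// subr_eq0. Qed.

Lemma measurable_fst_sub (c : R) : measurable_fun setT (fun p => p.1 - c).
Proof. exact: measurable_funB. Qed.

Lemma measurable_snd_sub (c : R) : measurable_fun setT (fun p => p.2 - c).
Proof. exact: measurable_funB. Qed.

(** Multiplying by the square of [p.1 - s.1.1] clears the division. The strict upper inequality
    forces this square to be nonzero. *)
Lemma sectorE s : sector s =
  [set p | s.2.1 * ((p.1 - s.1.1) * (p.1 - s.1.1)) <= (p.2 - s.1.2) * (p.1 - s.1.1)]
  `\` [set p | s.2.2 * ((p.1 - s.1.1) * (p.1 - s.1.1)) <= (p.2 - s.1.2) * (p.1 - s.1.1)].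
Proof.
apply/seteqP; split=> p.
  move=> [/[dup] ps + /andP[]]; rewrite -subr_eq0 => h0 ms sm.
  have h2 : 0 < (p.1 - s.1.1) * (p.1 - s.1.1) by rewrite -expr2 exprn_even_gt0.
  split=> /=; first by rewrite slopeE// -mulrA ler_pM2r.
  by apply/negP; rewrite -ltNge slopeE// -mulrA ltr_pM2r.
move=> /= [le1 /negP]; rewrite -ltNge => lt2.
have ps : p.1 != s.1.1.
  by apply: contraTneq lt2 => ->; rewrite subrr !mulr0 ltxx.
have h0 : p.1 - s.1.1 != 0 by rewrite subr_eq0.
have h2 : 0 < (p.1 - s.1.1) * (p.1 - s.1.1) by rewrite -expr2 exprn_even_gt0.
split=> //; apply/andP; move: le1 lt2.
by rewrite slopeE// -mulrA ler_pM2r// ltr_pM2r.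
Qed.

Lemma measurable_sector s : measurable (sector s).
Proof.
have mq : measurable_fun setT (fun p => (p.2 - s.1.2) * (p.1 - s.1.1)).
  by apply: measurable_funM; [exact: measurable_snd_sub|exact: measurable_fst_sub].
have mh c : measurable_fun setT (fun p => c * ((p.1 - s.1.1) * (p.1 - s.1.1))).
  apply: measurable_funM => //.
  by apply: measurable_funM; exact: measurable_fst_sub.
by rewrite sectorE; apply: measurableD; exact: measurable_le_fun.
Qed.

Definition slab a (m w : R) : set (R * R) :=
  [set p | `|p.2 - a.2 - m * (p.1 - a.1)| <= w].

Definition vslab a (w : R) : set (R * R) := [set p | `|p.1 - a.1| <= w].

Lemma measurable_slab a m w : measurable (slab a m w).
Proof.
apply: measurable_le_fun => //; apply: measurableT_comp => //.
apply: measurable_funB; first exact: measurable_snd_sub.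
by apply: measurable_funM => //; exact: measurable_fst_sub.
Qed.

Lemma measurable_vslab a w : measurable (vslab a w).
Proof.
apply: measurable_le_fun => //; apply: measurableT_comp => //.
exact: measurable_fst_sub.
Qed.

Lemma vol_slab_le a0 a m w : 0 <= w -> vol a0 (slab a m w) <= 8 * w.
Proof.
move=> w0; apply: (@vol_slab _ _ _ (fun x => a.2 + m * (x - a.1))) => //.
  exact: measurable_slab.
by move=> p + _; rewrite /slab/= opprD addrA.
Qed.

Lemma vol_vslab_le a0 a w : 0 <= w -> vol a0 (vslab a w) <= 8 * w.
Proof.
by move=> w0; apply: (@vol_vslab _ _ _ a.1) => //; exact: measurable_vslab.
Qed.

Definition near_pt (r : R) a b := `|b.1 - a.1| <= r /\ `|b.2 - a.2| <= r.

Lemma near_ptC r a b : near_pt r a b -> near_pt r b a.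
Proof. by case=> ? ?; split; rewrite distrC. Qed.

Lemma near_pt_trans r r' a b c :
  near_pt r a b -> near_pt r' b c -> near_pt (r + r') a c.
Proof.
move=> [ab1 ab2] [bc1 bc2]; split.
- by rewrite -(subrKA b.1) addrC (le_trans (ler_normD _ _))// lerD.
- by rewrite -(subrKA b.2) addrC (le_trans (ler_normD _ _))// lerD.
Qed.

Lemma opposite_le (x y c : R) : x * y <= 0 -> `|x - y| <= c -> `|x| <= c.
Proof.
move=> xy; rewrite !ler_norml => /andP[? ?].
have [x0|x0|x0] := ltgtP x 0; apply/andP; split; nra.
Qed.

(** Off the vertical strip, [p] lies on the same side of both apexes. If only [b] sees it within the
    slope range, then for one end slope [c] it lies between the parallel lines of slope [c] through
    [a] and [b], whose vertical distance is at most [(1 + |c|) * r]. *)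
Lemma sector_shift a b (al be r : R) : near_pt r a b ->
  sector (b, (al, be)) `\` sector (a, (al, be)) `<=`
  slab a al ((1 + `|al|) * r) `|` slab a be ((1 + `|be|) * r) `|` vslab a r.
Proof.
move=> [ab1 ab2] p [[/= pb /andP[/= alm mbe]] Nsa].
have [?|rh] := leP `|p.1 - a.1| r; first by right.
left.
have pa : p.1 != a.1.
  by rewrite -subr_eq0 -normr_gt0 (le_lt_trans _ rh)// (le_trans _ ab1).
have hh : 0 < (p.1 - a.1) * (p.1 - b.1).
  move: rh ab1; rewrite ler_norml => + /andP[? ?].
  by case: (ger0P (p.1 - a.1)) => ? ?; nra.
have lin c : `|(p.2 - a.2 - c * (p.1 - a.1)) - (p.2 - b.2 - c * (p.1 - b.1))|
    <= (1 + `|c|) * r.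
  rewrite (_ : _ - _ = (b.2 - a.2) - c * (b.1 - a.1)); last by ring.
  rewrite (le_trans (ler_normB _ _))// mulrDl mul1r lerD// normrM.
  by rewrite ler_wpM2l.
have prod c : (p.2 - a.2 - c * (p.1 - a.1)) * (p.2 - b.2 - c * (p.1 - b.1)) =
    (slope a p - c) * (slope b p - c) * ((p.1 - a.1) * (p.1 - b.1)).
  by rewrite (slopeE pa) (slopeE pb); ring.
have [alm'|] := ltP (slope a p) al.
  left; apply: (opposite_le _ (lin al)); rewrite prod.
  apply: mulr_le0_ge0; last exact: ltW.
  by apply: mulr_le0_ge0; [rewrite subr_le0 ltW|rewrite subr_ge0].
move=> alm'; right; apply: (opposite_le _ (lin be)); rewrite prod.
have be' : be <= slope a p.
  by rewrite leNgt; apply/negP => H; apply: Nsa; split => //; apply/andP.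
apply: mulr_le0_ge0; last exact: ltW.
by apply: mulr_ge0_le0; [rewrite subr_ge0|rewrite subr_le0 ltW].
Qed.

Lemma vol_sector_shift a0 a b (al be r : R) : 0 <= r -> near_pt r a b ->
  vol a0 (sector (b, (al, be)) `\` sector (a, (al, be))) <=
  8 * (3 + `|al| + `|be|) * r.
Proof.
move=> r0 ab; have cv := content_vol a0.
have m1 := measurable_slab a al ((1 + `|al|) * r).
have m2 := measurable_slab a be ((1 + `|be|) * r).
have m3 := measurable_vslab a r.
have m12 := measurableU _ _ m1 m2.
apply: le_trans (content_le cv _ _ (sector_shift ab)) _.
- by apply: measurableD; exact: measurable_sector.
- exact: measurableU.
apply: le_trans (contentU_le cv m12 m3) _.
have w0 (m : R) : 0 <= (1 + `|m|) * r by rewrite mulr_ge0// addr_ge0.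
have v12 := le_trans (contentU_le cv m1 m2)
  (lerD (vol_slab_le a0 a al (w0 al)) (vol_slab_le a0 a be (w0 be))).
apply: le_trans (lerD v12 (vol_vslab_le a0 a r0)) _.
by rewrite le_eqVlt; apply/orP; left; apply/eqP; ring.
Qed.

(* The identity [key_eq] below says that the slopes of [p] seen from [a] and [b]
   differ except near the line through [a] and [b]. *)
Lemma vol_same_slope a0 a b Z l : a != b -> measurable Z -> 0 <= l ->
  (forall p, Z p -> [/\ p.1 != a.1, p.1 != b.1 & `|slope a p - slope b p| <= l]) ->
  vol a0 Z <= 8 * ((2 + `|a0.1 - a.1|) * (2 + `|a0.1 - b.1|)
    / (if b.1 == a.1 then `|b.2 - a.2| else `|b.1 - a.1|)) * l.
Proof.
move=> ab mZ l0 Zl; set M := _ * (2 + _); set D := if _ then _ else _.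
have M0 : 0 <= M by rewrite mulr_ge0// addr_ge0.
have box_le c p : box a0 p -> `|p.1 - c| <= 2 + `|a0.1 - c|.
  by move=> [bp _]; rewrite -(subrKA a0.1) (le_trans (ler_normD _ _))// lerD2r.
have key_eq p : p.1 != a.1 -> p.1 != b.1 ->
    (b.2 - a.2) * (p.1 - a.1) - (b.1 - a.1) * (p.2 - a.2) =
    (slope a p - slope b p) * ((p.1 - a.1) * (p.1 - b.1)).
  move=> pa pb; transitivity (slope a p * (p.1 - a.1) * (p.1 - b.1)
    - slope b p * (p.1 - b.1) * (p.1 - a.1)); last by ring.
  by rewrite -(slopeE pa) -(slopeE pb); ring.
have key p : Z p -> box a0 p ->
    `|(b.2 - a.2) * (p.1 - a.1) - (b.1 - a.1) * (p.2 - a.2)| <= l * M.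
  move=> /Zl[pa pb pl] bp; rewrite key_eq//.
  by rewrite !normrM ler_pM// ler_pM// box_le.
rewrite -mulrA (_ : M / D * l = l * M / D); last by ring.
have D0 : 0 < D.
  rewrite /D; case: ifPn => [/eqP ba1|]; rewrite normr_gt0 subr_eq0//.
  apply: contra ab => /eqP ba2; apply/eqP.
  by rewrite [a]surjective_pairing [b]surjective_pairing ba1 ba2.
have lMD0 : 0 <= l * M / D by rewrite divr_ge0 ?mulr_ge0// ltW.
(* If [a] and [b] have the same abscissa, the line through them is vertical and a vertical strip
   takes the place of the slab. *)
move: D0 lMD0; rewrite /D; case: ifPn => [/eqP ba1|ba1] D0 lMD0.
  apply: (vol_vslab (s := a.1)) => // p Zp bp; rewrite ler_pdivlMr// mulrC -normrM.
  by move: (key p Zp bp); rewrite ba1 subrr mul0r subr0.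
apply: (vol_slab (phi := fun x => a.2 + (b.2 - a.2) / (b.1 - a.1) * (x - a.1))) => //.
move=> p Zp bp; rewrite ler_pdivlMr// -normrM.
rewrite (_ : _ * (b.1 - a.1) =
    - ((b.2 - a.2) * (p.1 - a.1) - (b.1 - a.1) * (p.2 - a.2))).
  by rewrite normrN; exact: key.
by field; rewrite subr_eq0.
Qed.

End sectors.

(** * Refinements *)

Section thinning.
Context {R : realType}.
Local Notation piece := ((R * R) * (R * R))%type.
Implicit Types (a b p : R * R) (s t : piece) (c : seq piece).
Variables (A : set (R * R)) (a0 : R * R).

Definition cover c : set (R * R) := \big[setU/set0]_(s <- c) sector s.

Lemma measurable_cover c : measurable (cover c).
Proof. by apply: bigsetU_measurable => s _; exact: measurable_sector. Qed.

Lemma cover_cat c1 c2 : cover (c1 ++ c2) = cover c1 `|` cover c2.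
Proof. exact: big_cat. Qed.

Lemma cover1 s : cover [:: s] = sector s.
Proof. exact: big_seq1. Qed.

(** Slopes are tracked one at a time: following a fixed slope through successive refinements yields
    a sequence of apexes in [A]. *)
Definition refines (eta : R) c c' :=
  (forall t, t \in c' -> A t.1) /\
  (forall s m, s \in c -> slopes s m ->
     exists t, [/\ t \in c', near_pt eta s.1 t.1 & slopes t m]).

Lemma refines_trans e1 e2 c1 c2 c3 :
  refines e1 c1 c2 -> refines e2 c2 c3 -> refines (e1 + e2) c1 c3.
Proof.
move=> [_ r12] [A3 r23]; split=> // s m sc1 sm.
have [t [tc2 st tm]] := r12 _ _ sc1 sm.
have [u [uc3 tu um]] := r23 _ _ tc2 tm.
by exists u; split=> //; exact: near_pt_trans tu.
Qed.

Lemma refines_cat e c1 c2 c1' c2' : refines e c1 c1' -> refines e c2 c2' ->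
  refines e (c1 ++ c2) (c1' ++ c2').
Proof.
move=> [A1 r1] [A2 r2]; split=> [t|s m]; rewrite mem_cat.
  by case/orP; [exact: A1|exact: A2].
by case/orP => [/r1|/r2] /[apply] -[t [tc st tm]]; exists t;
  rewrite mem_cat tc ?orbT.
Qed.

(** This is attainability of the factor [rho]. *)
Definition thinnable (rho : R) := forall f, content a0 f ->
  forall s, A s.1 -> forall e eta, 0 < e -> 0 < eta ->
  exists c, refines eta [:: s] c /\ f (cover c) <= rho * f (sector s) + e.

Lemma near_pt_refl (eta : R) a : 0 <= eta -> near_pt eta a a.
Proof. by move=> eta0; split; rewrite subrr normr0. Qed.

Lemma thinnable1 : thinnable 1.
Proof.
move=> f cf s As e eta e0 eta0; exists [:: s]; rewrite cover1; split; last by lra.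
split=> [t|t m]; rewrite inE => /eqP -> // sm.
by exists s; rewrite inE; split=> //; apply: near_pt_refl; exact: ltW.
Qed.

(** The pieces are thinned one by one and the results combined by subadditivity. For disjoint pieces
    the sum on the right is the content of their union. *)
Lemma thinnable_seq rho f c : thinnable rho -> content a0 f ->
  (forall s, s \in c -> A s.1) -> forall e eta, 0 < e -> 0 < eta ->
  exists c', refines eta c c' /\
    f (cover c') <= rho * \sum_(s <- c) f (sector s) + e.
Proof.
move=> rhoP cf; elim: c => [_ e eta e0 eta0|s c IH Ac e eta e0 eta0].
  exists [::]; split; first by split.
  by rewrite /cover !big_nil (content0 cf); lra.
have [|//||c1 [rc1 fc1]] := IH _ (e / 2) eta; last 1 first.
- have [|//||c2 [rc2 fc2]] := rhoP f cf s _ (e / 2) eta; last 1 first.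
  + exists (c2 ++ c1); split; first exact: (refines_cat rc2 rc1).
    rewrite cover_cat big_cons.
    have := contentU_le cf (measurable_cover c2) (measurable_cover c1); lra.
  + by apply: Ac; rewrite mem_head.
  + lra.
  + by [].
- by move=> t tc; apply: Ac; rewrite inE tc orbT.
- lra.
- by [].
Qed.

Lemma thinnableW (rho rho' : R) : rho <= rho' -> thinnable rho -> thinnable rho'.
Proof.
move=> le rhoP f cf s As e eta e0 eta0.
have [c [rc fc]] := rhoP f cf s As e eta e0 eta0.
exists c; split=> //; apply: le_trans fc _; rewrite lerD2r ler_wpM2r//.
by apply: (content_ge0 cf); exact: measurable_sector.
Qed.

(** * Subdivision of a sector into cells of equal slope width *)

Section cells.
Variables (n : nat).
Implicit Type k : 'I_n.

Definition mesh s : R := (s.2.2 - s.2.1) / n%:R.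

Definition cell s (k : nat) : R * R :=
  (s.2.1 + k%:R * mesh s, s.2.1 + k.+1%:R * mesh s).

(** Truncation reads the index of a cell off any of its slopes, which makes different cells
    disjoint. *)
Lemma cell_index s (k : nat) a m : slopes (a, cell s k) m ->
  0 < mesh s /\ Num.truncn ((m - s.2.1) / mesh s) = k.
Proof.
move=> /andP[/= le1 lt2].
have l0 : 0 < mesh s by move: lt2; rewrite -addn1 natrD; lra.
split=> //; apply: truncn_def; rewrite ler_pdivlMr// ltr_pdivrMr//.
by apply/andP; split; lra.
Qed.

Lemma cell_disj s a (j k : nat) : j != k ->
  sector (a, cell s j) `&` sector (a, cell s k) = set0.
Proof.
move=> jk; rewrite -subset0 => p [[_ /cell_index[_ pj]] [_ /cell_index[_ pk]]].
by move: jk; rewrite -pj -pk eqxx.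
Qed.

Lemma sub_cell s k a m : slopes (a, cell s k) m -> slopes s m.
Proof.
move=> /[dup] /cell_index[l0 _] /andP[/= le1 lt2]; apply/andP; split.
  by apply: le_trans le1; rewrite lerDl mulr_ge0// ltW.
apply: (lt_le_trans lt2).
have n0 : 0 < n%:R :> R by rewrite ltr0n (leq_ltn_trans _ (ltn_ord k)).
have -> : s.2.2 = s.2.1 + n%:R * mesh s by rewrite /mesh mulrC divfK ?gt_eqF//; ring.
by rewrite lerD2l ler_pM2r// ler_nat.
Qed.

Lemma exists_cell s m a : (0 < n)%N -> slopes s m -> exists k, slopes (a, cell s k) m.
Proof.
move=> n0 /andP[le1 lt2].
have n0' : 0 < n%:R :> R by rewrite ltr0n.
have l0 : 0 < mesh s by rewrite divr_gt0// subr_gt0 (le_lt_trans le1).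
have x0 : 0 <= (m - s.2.1) / mesh s by rewrite divr_ge0 ?subr_ge0// ltW.
have /andP[tle tlt] := truncn_itv x0.
have kn : (Num.truncn ((m - s.2.1) / mesh s) < n)%N.
  rewrite -(ltr_nat R) (le_lt_trans tle)// ltr_pdivrMr//.
  by rewrite /mesh mulrC divfK ?gt_eqF//; lra.
exists (Ordinal kn); move: tle tlt; rewrite ler_pdivlMr// ltr_pdivrMr// => ? ?.
by apply/andP; split=> /=; lra.
Qed.

Lemma sector_cells s a : (0 < n)%N ->
  sector (a, s.2) = \big[setU/set0]_(k < n) sector (a, cell s k).
Proof.
move=> n0; rewrite -(bigcup_mkord n (fun k : nat => sector (a, cell s k))).
apply/seteqP; split=> p.
  move=> [/= pa sl]; have [k kp] := @exists_cell s _ a n0 sl.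
  by exists k => //=; split.
by move=> [k /= kn [pa kp]]; split => //; exact: (@sub_cell s (Ordinal kn) a).
Qed.

End cells.
End thinning.

(** * Improving the attainable factor *)

Section improvement.
Context {R : realType}.
Local Notation piece := ((R * R) * (R * R))%type.
Implicit Types (a b p : R * R) (s t : piece) (c : seq piece).
Variables (A : set (R * R)) (a0 : R * R).

(* Each cell stays at [a] or moves to [b]; a fair coin per cell puts a point whose two
   slopes lie in different cells into both unions with probability 1/4. *)
Lemma exists_allocation f a b s n (rho e : R) : content a0 f ->
  0 <= rho <= 1 -> 0 < e -> s.1 = a -> (0 < n)%N ->
  vol a0 (sector (b, s.2) `\` sector s) <= e ->
  vol a0 (sector s `\` sector (b, s.2)) <= e ->
  vol a0 (\big[setU/set0]_(k < n)
    (sector (a, cell n s k) `&` sector (b, cell n s k))) <= e ->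
  exists g : {ffun 'I_n -> bool},
    let R0 := \big[setU/set0]_(k < n | g k) sector (a, cell n s k) in
    let R1 := \big[setU/set0]_(k < n | ~~ g k) sector (b, cell n s k) in
    [/\ f R0 = \sum_(k < n | g k) f (sector (a, cell n s k)),
        f R1 = \sum_(k < n | ~~ g k) f (sector (b, cell n s k)) &
        f R0 + f R1 - rho * f (R0 `&` R1) <= (1 - rho / 4) * f (sector s) + e].
Proof.
move=> cf /andP[rho0 rho1] e0 sa n0 vba vab vZ.
pose F (k : 'I_n) := sector (a, cell n s k).
pose G (k : 'I_n) := sector (b, cell n s k).
have mF k : measurable (F k) by exact: measurable_sector.
have mG k : measurable (G k) by exact: measurable_sector.
have dF (i j : 'I_n) : i != j -> F i `&` F j = set0 by exact: cell_disj.
have dG (i j : 'I_n) : i != j -> G i `&` G j = set0 by exact: cell_disj.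
have ur : uniq (index_enum 'I_n) by exact: index_enum_uniq.
have fFG (P Q : pred 'I_n) :
    f ((\big[setU/set0]_(k | P k) F k) `&` \big[setU/set0]_(l | Q l) G l) =
    \sum_(k | P k) \sum_(l | Q l) f (F k `&` G l).
  rewrite (content_bigUI cf)//; last exact: bigsetU_measurable.
  apply: eq_bigr => k _; rewrite setIC (content_bigUI cf)//.
  by apply: eq_bigr => l _; rewrite setIC.
have [g gP] := exists_coins (fun k => f (F k)) (fun l => f (G l))
  (fun k l => f (F k `&` G l)) rho.
exists g => R0 R1.
have fR0 : f R0 = \sum_(k | g k) f (F k) by exact: (content_bigU cf g ur mF dF).
have fR1 : f R1 = \sum_(k | ~~ g k) f (G k)
  by exact: (content_bigU cf (fun k => ~~ g k) ur mG dG).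
split=> //; rewrite fFG fR0 fR1; apply: le_trans gP _.
have Sa : sector s = \big[setU/set0]_k F k.
  by rewrite {1}[s]surjective_pairing sa; exact: sector_cells.
have Sb : sector (b, s.2) = \big[setU/set0]_k G k by exact: sector_cells.
rewrite -(content_bigU cf)// -(content_bigU cf)// -Sa -Sb.
have mSa := measurable_sector s; have mSb := measurable_sector (b, s.2).
have ba : f (sector (b, s.2)) <= f (sector s) + e.
  rewrite (content_split cf mSb mSa) lerD//.
    by apply: (content_le cf) => //; exact: measurableI.
  by apply: le_trans vba; apply: (content_le_vol cf); exact: measurableD.
have ab : f (sector s) - e <= f (sector s `&` sector (b, s.2)).
  rewrite [X in X - _](content_split cf mSa mSb) -addrA gerDl subr_le0.
  by apply: le_trans vab; apply: (content_le_vol cf); exact: measurableD.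
have diag : \sum_k f (F k `&` G k) <= e.
  rewrite -(content_bigU cf)//; last 2 first.
  - by move=> k; exact: measurableI.
  - by move=> i j ij; rewrite setIACA dF// set0I.
  apply: le_trans vZ; apply: (content_le_vol cf).
  by apply: bigsetU_measurable => k _; exact: measurableI.
(* One [e] is lost by moving the apex, another on the diagonal pairs of cells. *)
have offdiag : f (sector s) - 2 * e <= \sum_k \sum_(l | l != k) f (F k `&` G l).
  have : \sum_k f (F k `&` G k) + \sum_k \sum_(l | l != k) f (F k `&` G l) =
      f (sector s `&` sector (b, s.2)).
    rewrite Sa Sb fFG -big_split; apply: eq_bigr => k _ /=.
    by rewrite [RHS](bigD1 k).
  move=> fE; move: ab; rewrite -fE => ab; clear -ab diag; move: ab diag.
  move: (\sum_k f _) (\sum_k _) (f (sector s)) => x y z; lra.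
(* The errors are [e / 2] from the moved sector and [rho * e / 2] from the off-diagonal sum;
   together they are at most [e] because [rho <= 1]. *)
clear -ba offdiag rho0 rho1 e0; move: ba offdiag.
move: (f (sector s)) (f (sector (b, s.2))) (\sum_k _) => x y z ? ?; nra.
Qed.

Hypothesis Acc : forall a r, A a -> 0 < r ->
  exists b, [/\ A b, a != b & near_pt r a b].

Lemma thinnable_step rho : 0 <= rho <= 1 ->
  thinnable A a0 rho -> thinnable A a0 (rho - rho ^+ 2 / 4).
Proof.
move=> /[dup] rho01 /andP[rho0 rho1] rhoP f cf s As e eta e0 eta0.
case: s As => a [al be] As; pose s := (a, (al, be)).
(* Three errors of size at most [e1] occur: one from the allocation and one from each of the two
   thinnings. *)
pose e1 := e / 4; have e10 : 0 < e1 by rewrite /e1; lra.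
pose K := 8 * (3 + `|al| + `|be|).
have K0 : 0 < K by rewrite /K; have := normr_ge0 al; have := normr_ge0 be; lra.
(* The first bound leaves [eta / 2] for the later thinning; the second makes the sectors at [a] and
   [b] differ by area at most [e1]. *)
pose r := Num.min (eta / 2) (e1 / K).
have r0 : 0 < r by rewrite lt_min divr_gt0//= divr_gt0.
have re : r <= eta / 2 by rewrite ge_min lexx.
have rK : K * r <= e1 by rewrite mulrC -ler_pdivlMr// ge_min lexx orbT.
have [b [Ab ab nab]] := Acc As r0.
pose M := 8 * ((2 + `|a0.1 - a.1|) * (2 + `|a0.1 - b.1|)
    / (if b.1 == a.1 then `|b.2 - a.2| else `|b.1 - a.1|)).
have M0 : 0 <= M.
  rewrite !mulr_ge0 ?addr_ge0 ?invr_ge0//; by case: ifP.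
(* [M] depends on the distance from [a] to [b], so the number of cells is chosen after [b]. *)
pose L := M * `|be - al| / e1.
pose n := (Num.truncn L).+1.
have nL : M * (`|be - al| / n%:R) <= e1.
  have := truncnS_gt L => Ln.
  rewrite mulrA ler_pdivrMr ?ltr0n// (mulrC e1) -ler_pdivrMr//.
  exact: ltW.
have n0 : (0 < n)%N by [].
clearbody n.
have vZ : vol a0 (\big[setU/set0]_(k < n)
    (sector (a, cell n s k) `&` sector (b, cell n s k))) <= e1.
  apply: le_trans nL; apply: vol_same_slope => //.
  - by apply: bigsetU_measurable => k _; apply: measurableI; exact: measurable_sector.
  - rewrite -(bigcup_mkord n (fun k : nat => sector (a, cell n s k) `&` sector (b, cell n s k))).
    move=> p [k kn [[pa /andP[/= a1 a2]] [pb /andP[/= b1 b2]]]]; split=> //.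
    have -> : `|be - al| / n%:R = mesh n s.
      have l0 : 0 < mesh n s by move: (le_lt_trans a1 a2); rewrite -addn1 natrD; lra.
      rewrite /mesh/= ger0_norm//.
      by move: l0; rewrite /mesh/= pmulr_lgt0 ?invr_gt0 ?ltr0n// => /ltW.
    move: a1 a2 b1 b2; rewrite -addn1 natrD mulrDl mul1r addrA ler_norml.
    by move=> *; apply/andP; split; lra.
have vba : vol a0 (sector (b, s.2) `\` sector s) <= e1.
  by apply: le_trans rK; apply: vol_sector_shift => //; exact: ltW.
have vab : vol a0 (sector s `\` sector (b, s.2)) <= e1.
  apply: le_trans rK; apply: vol_sector_shift; first exact: ltW.
  exact: near_ptC.
have [g [fR0 fR1 gP]] := exists_allocation cf rho01 e10 (erefl : s.1 = a)
  n0 vba vab vZ.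
set R0 := \big[setU/set0]_(k < _ | g k) _ in fR0 gP.
set R1 := \big[setU/set0]_(k < _ | ~~ g k) _ in fR1 gP.
pose c0 := [seq (a, cell n s k) | k : 'I_n <- index_enum 'I_n & g k].
pose c1 := [seq (b, cell n s k) | k : 'I_n <- index_enum 'I_n & ~~ g k].
have mR0 : measurable R0 by apply: bigsetU_measurable => k _; exact: measurable_sector.
have mR1 : measurable R1 by apply: bigsetU_measurable => k _; exact: measurable_sector.
have c0A t : t \in c0 -> A t.1 by move=> /mapP[k _ ->].
have c1A t : t \in c1 -> A t.1 by move=> /mapP[k _ ->].
have e2 : 0 < eta / 2 by rewrite divr_gt0.
have [d0 [rd0 fd0]] := thinnable_seq rhoP (content_reweight cf rho01 mR1) c0A e10 e2.
have mU0 := measurable_cover d0.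
have [d1 [rd1 fd1]] := thinnable_seq rhoP (content_setD cf mU0) c1A e10 e2.
have mU1 := measurable_cover d1.
exists (d0 ++ d1); split.
  rewrite (_ : eta = eta / 2 + eta / 2); last by field.
  apply: refines_trans (refines_cat rd0 rd1).
  split=> [t|t m]; first by rewrite mem_cat => /orP[/c0A|/c1A].
  rewrite inE => /eqP -> sm; have [k km] := exists_cell a n0 sm.
  have [gk|gk] := boolP (g k).
    exists (a, cell n s k); split=> //; last exact/near_pt_refl/ltW.
    by rewrite mem_cat map_f// mem_filter gk mem_index_enum.
  exists (b, cell n s k); split=> //.
    by rewrite mem_cat map_f ?orbT// mem_filter gk mem_index_enum.
  by case: nab => ? ?; split; apply: le_trans re.
rewrite cover_cat (contentU_split cf)//.
have sum0 h : \sum_(t <- c0) h (sector t) =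
    \sum_(k < n | g k) h (sector (a, cell n s k)) :> R.
  by rewrite big_map big_filter.
have sum1 h : \sum_(t <- c1) h (sector t) =
    \sum_(k < n | ~~ g k) h (sector (b, cell n s k)) :> R.
  by rewrite big_map big_filter.
have ur : uniq (index_enum 'I_n) by exact: index_enum_uniq.
have mS (a' : R * R) (k : 'I_n) : measurable (sector (a', cell n s k)).
  exact: measurable_sector.
have dS (a' : R * R) (i j : 'I_n) : i != j ->
  sector (a', cell n s i) `&` sector (a', cell n s j) = set0 by exact: cell_disj.
have f01 : f (R0 `&` R1) =
    \sum_(k < n | g k) f (sector (a, cell n s k) `&` R1).
  exact: (content_bigUI cf g ur (mS a) mR1 (dS a)).
have fR1U : f (R1 `\` cover d0) =
    \sum_(k < n | ~~ g k) f (sector (b, cell n s k) `\` cover d0).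
  exact: (content_bigU (content_setD cf mU0) (fun k => ~~ g k) ur (mS b) (dS b)).
move: fd0; rewrite /= (sum0 (fun X => f X - rho * f (X `&` R1))).
rewrite sumrB -mulr_sumr -f01 -fR0 => fd0.
move: fd1; rewrite /= (sum1 (fun X => f (X `\` cover d0))) -fR1U => fd1.
(* With this splitting of [f R1], adding the bounds for the two thinnings cancels [rho] times the
   content of [cover d0] inside [R1]. *)
have := content_split cf mR1 mU0; rewrite setIC => fR1E.
have rhog := ler_wpM2l rho0 gP.
have rhoe : rho * e1 <= e1 by rewrite ler_piMl// ltW.
rewrite /e1 in fd0 fd1 rhog rhoe.
rewrite (_ : (a, (al, be)) = s)//; clear -e0 fd0 fd1 fR1E rhog rhoe.
move: fR1E fd0 fd1 rhog rhoe; move: (f R0) (f R1) (f (R0 `&` R1)) (f (sector s))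
  (f (cover d0)) (f (cover d0 `&` R1)) (f (R1 `\` _)) (f (cover d1 `\` _)).
move=> x0 x1 x01 xs y0 y01 y1 z ? ? ? ? ?; nra.
Qed.

(** While the attained factor [m] is at least [rho], one step lowers it by [m ^+ 2 / 4], hence by at
    least the fixed amount [rho ^+ 2 / 4]; finitely many steps reach [rho]. *)
Lemma thinnable_all rho : 0 < rho -> thinnable A a0 rho.
Proof.
move=> rho0.
have [rho1|/ltW rho1] := leP rho 1; last first.
  exact: (thinnableW rho1 (@thinnable1 _ A a0)).
have iter k : thinnable A a0 (Num.max rho (1 - k%:R * (rho ^+ 2 / 4))).
  elim: k => [|k IH]; first by apply: (thinnableW _ (@thinnable1 _ A a0));
    rewrite le_max mul0r subr0 lexx orbT.
  set m := Num.max _ _ in IH.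
  have rm : rho <= m by rewrite le_max lexx.
  have m1 : m <= 1.
    by rewrite ge_max rho1/= lerBlDr lerDl mulr_ge0// divr_ge0// exprn_ge0// ltW.
  have mE : m = rho \/ m = 1 - k%:R * (rho ^+ 2 / 4).
    by rewrite /m /Num.max; case: ifP; [right|left].
  have m01 : 0 <= m <= 1 by rewrite m1 andbT (le_trans _ rm)// ltW.
  apply: (thinnableW _ (thinnable_step m01 IH)).
  rewrite le_max -(natr1 k); apply/orP.
  by case: mE => mE; [left|right]; rewrite mE; nra.
pose k := (Num.truncn ((rho ^+ 2 / 4)^-1)).+1.
apply: (thinnableW _ (iter k)); rewrite ge_max lexx/=.
have r2 : 0 < rho ^+ 2 / 4 by rewrite divr_gt0// exprn_gt0.
have := truncnS_gt (rho ^+ 2 / 4)^-1; rewrite -/k.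
rewrite -[ltLHS]mul1r ltr_pdivrMr// => /ltW; lra.
Qed.

End improvement.

(** * Fattened sectors *)

Section fattening.
Context {R : realType}.
Local Notation piece := ((R * R) * (R * R))%type.
Implicit Types (a b p : R * R) (s t : piece) (c : seq piece).

(** For [s.2.1 < s.2.2] this is the closed two-sided sector: the offsets from the two boundary lines
    do not have the same strict sign. *)
Definition wedge s : set (R * R) :=
  [set p | (p.2 - s.1.2 - s.2.1 * (p.1 - s.1.1)) *
           (p.2 - s.1.2 - s.2.2 * (p.1 - s.1.1)) <= 0].

(** For slopes of absolute value at most 1, moving the apex by [k] in each coordinate shifts a line
    vertically by at most [2 * k]. *)
Definition fat s (k : R) : set (R * R) :=
  slab s.1 s.2.1 (2 * k) `|` slab s.1 s.2.2 (2 * k) `|` wedge s.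

Lemma closed_le_fun (g : R * R -> R) (r : R) : continuous g ->
  closed [set p | g p <= r].
Proof. by move=> cg; apply: (@preimage_closed _ _ g [set x | x <= r]). Qed.

Lemma continuous_offset a m :
  continuous (fun p : R * R => p.2 - a.2 - m * (p.1 - a.1)).
Proof.
move=> p; apply: cvgB; first by apply: cvgB; [exact: cvg_snd|exact: cvg_cst].
apply: cvgM; first exact: cvg_cst.
by apply: cvgB; [exact: cvg_fst|exact: cvg_cst].
Qed.

Lemma closed_fat s k : closed (fat s k).
Proof.
apply: closedU; first (apply: closedU); apply: closed_le_fun => p.
- exact: (cvg_norm (@continuous_offset _ _ p)).
- exact: (cvg_norm (@continuous_offset _ _ p)).
- by apply: cvgM; exact: continuous_offset.
Qed.

Lemma measurable_wedge s : measurable (wedge s).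
Proof.
have mo m : measurable_fun setT (fun p => p.2 - s.1.2 - m * (p.1 - s.1.1)).
  apply: measurable_funB; first exact: measurable_snd_sub.
  by apply: measurable_funM => //; exact: measurable_fst_sub.
by apply: measurable_le_fun => //; exact: measurable_funM.
Qed.

Lemma measurable_fat s k : measurable (fat s k).
Proof.
apply: measurableU; last exact: measurable_wedge.
by apply: measurableU; exact: measurable_slab.
Qed.

(** Off both slabs a point of the wedge is on neither boundary line, so its slope is strictly inside
    the range. On the vertical line through the apex the wedge contains only the apex, which lies in
    the slabs. *)
Lemma fat_sub s k : 0 <= k -> s.2.1 < s.2.2 ->
  fat s k `<=` sector s `|` (slab s.1 s.2.1 (2 * k) `|` slab s.1 s.2.2 (2 * k)).
Proof.
move=> k0 lt12 p [?|wp]; first by right.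
have [?|/negP Na] := pselect (slab s.1 s.2.1 (2 * k) p); first by right; left.
have [?|/negP Nb] := pselect (slab s.1 s.2.2 (2 * k) p); first by right; right.
left; have ps : p.1 != s.1.1.
  apply/eqP => ps; apply: (negP Na).
  move: wp; rewrite /wedge /slab/= ps subrr !mulr0 !subr0 -expr2.
  by rewrite real_exprn_even_le0 ?num_real//= => /eqP ->; rewrite normr0 mulr_ge0.
split=> //; have h0 : p.1 - s.1.1 != 0 by rewrite subr_eq0.
have h2 : 0 < (p.1 - s.1.1) ^+ 2 by rewrite exprn_even_gt0.
move: wp; rewrite /wedge/= (slopeE ps) -!mulrBl mulrACA -expr2 pmulr_lle0// => sl.
move: Nb; rewrite /slab/= (slopeE ps) -mulrBl => Nb.
apply/andP; split; first by rewrite leNgt; apply/negP => ?; nra.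
rewrite lt_neqAle; apply/andP; split; last by rewrite leNgt; apply/negP => ?; nra.
apply: contra Nb => /eqP ->; rewrite subrr mul0r normr0.
by rewrite mulr_ge0.
Qed.

(** The line through [a] is within vertical distance [2 * k] of its parallel through the apex, which
    runs inside the wedge. If [p] is outside the wedge, a boundary line separates it from that
    parallel and is even closer. *)
Lemma mem_fat s k a m p : `|m| <= 1 -> slopes s m -> near_pt k s.1 a ->
  p.2 - a.2 = m * (p.1 - a.1) -> fat s k p.
Proof.
move=> m1 /andP[ms sm] [sa1 sa2] pE.
have D : `|(p.2 - s.1.2) - m * (p.1 - s.1.1)| <= 2 * k.
  rewrite (_ : _ - _ = (a.2 - s.1.2) - m * (a.1 - s.1.1)); last first.
    have -> : p.2 = m * (p.1 - a.1) + a.2 by rewrite -pE subrK.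
    by ring.
  rewrite (le_trans (ler_normB _ _))// mulr_natl mulr2n lerD// normrM.
  by rewrite -[leRHS]mul1r ler_pM.
rewrite /fat/slab/wedge/=.
move: D; set h := p.1 - _; set q := p.2 - _ => D.
have [|pos] := leP ((q - s.2.1 * h) * (q - s.2.2 * h)) 0; first by right.
left; move: D; rewrite !ler_norml => /andP[D1 D2].
(* The sign of [h] decides which boundary line is the upper one at [p]. *)
have [h0|h0] := leP 0 h.
  have H1 : s.2.1 * h <= m * h by rewrite ler_wpM2r.
  have H2 : m * h <= s.2.2 * h by rewrite ler_wpM2r// ltW.
  have [q0|q0] := leP (q - s.2.1 * h) 0; [left|right]; apply/andP; split; nra.
have H1 : m * h <= s.2.1 * h by rewrite ler_wnM2r// ltW.
have H2 : s.2.2 * h <= m * h by rewrite ler_wnM2r// ltW.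
have [q0|q0] := leP (q - s.2.1 * h) 0; [right|left]; apply/andP; split; nra.
Qed.

(** Pieces with an empty slope range are dropped because their wedges are not empty. *)
Definition fat_cover c (k : R) : set (R * R) :=
  \big[setU/set0]_(s <- [seq s <- c | s.2.1 < s.2.2]) fat s k.

Lemma closed_fat_cover c k : closed (fat_cover c k).
Proof. by apply: closed_bigsetU => s _; exact: closed_fat. Qed.

Lemma measurable_fat_cover c k : measurable (fat_cover c k).
Proof. by apply: bigsetU_measurable => s _; exact: measurable_fat. Qed.

Lemma sub_fat_cover c k s m : s \in c -> slopes s m -> fat s k `<=` fat_cover c k.
Proof.
move=> sc /andP[ms sm] p sp; rewrite /fat_cover -bigcup_seq.
by exists s => //=; rewrite mem_filter sc andbT (le_lt_trans ms).
Qed.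

(** Each piece adds two slabs of area at most [16 * k] in the box. *)
Lemma vol_fat_cover a0 c k : 0 <= k ->
  vol a0 (fat_cover c k) <= vol a0 (cover c) + (size c)%:R * (32 * k).
Proof.
move=> k0; pose L s := slab s.1 s.2.1 (2 * k) `|` slab s.1 s.2.2 (2 * k).
have cv := content_vol a0.
have mL s : measurable (L s) by apply: measurableU; exact: measurable_slab.
have vL s : vol a0 (L s) <= 32 * k.
  have mS m : measurable (slab s.1 m (2 * k)) by exact: measurable_slab.
  have k20 : 0 <= 2 * k by rewrite mulr_ge0.
  apply: le_trans (contentU_le cv (mS s.2.1) (mS s.2.2)) _.
  apply: le_trans (lerD (vol_slab_le a0 s.1 _ k20) (vol_slab_le a0 s.1 _ k20)) _.
  by rewrite le_eqVlt; apply/orP; left; apply/eqP; ring.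
have mB : measurable (\big[setU/set0]_(s <- c) L s) by exact: bigsetU_measurable.
have vB : vol a0 (\big[setU/set0]_(s <- c) L s) <= (size c)%:R * (32 * k).
  elim: (c) => [|s c' IH]; first by rewrite big_nil (content0 cv) mul0r.
  rewrite big_cons /= -natr1 mulrDl mul1r.
  have mB' : measurable (\big[setU/set0]_(t <- c') L t) by exact: bigsetU_measurable.
  by rewrite addrC; apply: le_trans (contentU_le cv (mL s) mB') (lerD (vL s) IH).
apply: le_trans (_ : vol a0 (cover c `|` \big[setU/set0]_(s <- c) L s) <= _).
  apply: (content_le cv); first exact: measurable_fat_cover.
    by apply: measurableU => //; exact: measurable_cover.
  rewrite /fat_cover /cover -!bigcup_seq => p [s /=].
  rewrite mem_filter => /andP[s12 sc] /(fat_sub k0 s12)[?|?]; [left|right];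
  by exists s.
by apply: le_trans (contentU_le cv (measurable_cover c) mB) _; rewrite lerD2l.
Qed.

End fattening.

(** * The limit set *)

Section construction.
Context {R : realType}.
Local Notation piece := ((R * R) * (R * R))%type.
Implicit Types (a b p : R * R) (s t : piece) (c : seq piece).
Local Notation lam := (@lebesgue_measure2 R).
Variable A : set (R * R).
Hypothesis Acc : forall a r, A a -> 0 < r ->
  exists b, [/\ A b, a != b & near_pt r a b].
Hypothesis Acl : forall a, (forall r, 0 < r -> exists2 b, A b & near_pt r a b) -> A a.

(** The intervals of radius [k n] about [x n] are nested, and the supremum of their left ends
    belongs to all of them. *)
Lemma trapped_limit (x k : nat -> R) :
  (forall n, `|x n.+1 - x n| <= k n - k n.+1) -> (forall n, 0 <= k n) ->
  exists l, forall n, `|l - x n| <= k n.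
Proof.
move=> xk k0.
have nd n j : x n - k n <= x (n + j)%N - k (n + j)%N /\
              x (n + j)%N + k (n + j)%N <= x n + k n.
  elim: j => [|j [IH1 IH2]]; first by rewrite addn0.
  by have := xk (n + j)%N; rewrite addnS ler_norml => /andP[? ?]; split; lra.
have ub n m : x m - k m <= x n + k n.
  have [nm|/ltnW mn] := leqP n m.
    by have [_] := nd n (m - n)%N; rewrite subnKC//; have := k0 m; lra.
  by have [+ _] := nd m (n - m)%N; rewrite subnKC//; have := k0 n; lra.
pose S := range (fun n => x n - k n).
have S0 : S !=set0 by exists (x 0%N - k 0%N); exists 0%N.
have Sub n : ubound S (x n + k n) by move=> _ [m _ <-]; exact: ub.
exists (sup S) => n; rewrite ler_norml; apply/andP; split.
  have : x n - k n <= sup S.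
    by apply: sup_upper_bound; [split=> //; exists (x 0%N + k 0%N)|exists n].
  lra.
by have := ge_sup S0 (Sub n); lra.
Qed.

Definition valid (st : seq piece * R) := 0 < st.2 /\ forall s, s \in st.1 -> A s.1.

(** Half of the radius pays for the present move of the apexes; the other half bounds the new radius
    and so all later moves. *)
Lemma refinement_step a0 st e : valid st -> 0 < e -> exists st',
  [/\ valid st', st'.2 <= st.2 / 2, refines A (st.2 / 2) st.1 st'.1 &
      vol a0 (fat_cover st'.1 st'.2) <= e].
Proof.
case: st => c k [/= k0 Ac] e0.
have cv := content_vol a0.
pose S := \sum_(s <- c) vol a0 (sector s).
have S0 : 0 <= S.
  by apply: sumr_ge0 => s _; apply: (content_ge0 cv); exact: measurable_sector.
(* Adding 1 to [S] keeps the denominator positive. *)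
pose rho := e / (4 * (S + 1)).
have rho0 : 0 < rho by rewrite divr_gt0// mulr_gt0//; lra.
have rhoS : rho * S <= e / 4.
  rewrite (_ : e / 4 = rho * (S + 1)); first by rewrite ler_wpM2l ?ltW//; lra.
  by rewrite /rho; field; rewrite lt0r_neq0//; lra.
have e4 : 0 < e / 4 by lra.
have k2 : 0 < k / 2 by lra.
have [c' [rcc' vc']] := thinnable_seq (thinnable_all Acc rho0) cv Ac e4 k2.
(* The second bound limits the area added by fattening to [e / 4]; the successor covers an empty
   list. *)
pose k' := Num.min (k / 2) (e / 4 / (32 * (size c').+1%:R)).
have n0 : 0 < (size c').+1%:R :> R by rewrite ltr0n.
have k'0 : 0 < k' by rewrite lt_min !divr_gt0// mulr_gt0.
exists (c', k'); split => //=; first by split=> //; exact: rcc'.1.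
  by rewrite /k' ge_min lexx.
apply: le_trans (vol_fat_cover _ _ (ltW k'0)) _.
have : k' * (32 * (size c').+1%:R) <= e / 4.
  by rewrite -ler_pdivlMr ?mulr_gt0// /k' ge_min lexx orbT.
rewrite -(natr1 (size c')) -/S in vc' *.
nra.
Qed.

(** The initial slope range is half-open, so its upper end is taken beyond 1 in order to include
    slope 1. *)
Lemma exists_scheme a0 : A a0 -> exists st : nat -> seq piece * R,
  [/\ st 0%N = ([:: (a0, (-1, 2))], 2^-1), forall n, valid (st n),
      forall n, (st n.+1).2 <= (st n).2 / 2,
      forall n, refines A ((st n).2 / 2) (st n).1 (st n.+1).1 &
      forall n, vol a0 (fat_cover (st n.+1).1 (st n.+1).2) <= n.+1%:R^-1].
Proof.
move=> Aa0.
have step (x : nat * (seq piece * R)) : exists st', valid x.2 ->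
  [/\ valid st', st'.2 <= x.2.2 / 2, refines A (x.2.2 / 2) x.2.1 st'.1 &
      vol a0 (fat_cover st'.1 st'.2) <= x.1.+1%:R^-1].
  have [vx|nvx] := pselect (valid x.2); last by exists x.2.
  have [|st' st'P] := refinement_step a0 vx (e := x.1.+1%:R^-1); last by exists st'.
  by rewrite invr_gt0 ltr0n.
have [F FP] := choice step.
pose st := nat_rect (fun=> (seq piece * R)%type) ([:: (a0, (-1, 2))], 2^-1)
  (fun n x => F (n, x)).
have vst n : valid (st n).
  elim: n => [|n IH]; last by have [] := FP (n, st n) IH.
  by split=> /= [|s]; [rewrite invr_gt0|rewrite inE => /eqP ->].
by exists st; split=> // n; have [] := FP (n, st n) (vst n).
Qed.

(** [E] is the intersection of all fattened covers with the box. For a slope [m], the pieces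
    containing [m] are followed through the stages; their apexes converge to a point of [A], and the
    line of slope [m] through it lies in every fattened cover. *)
Lemma bounded_slopes a0 : A a0 -> exists E : set (R * R),
  [/\ measurable E, compact E, lam E = 0%E & forall m, `|m| <= 1 ->
      exists2 a, A a & forall u, `|u| <= 2^-1 -> E (a.1 + u, a.2 + u * m)].
Proof.
move=> Aa0; have [st [st0 vst kst rst volst]] := exists_scheme Aa0.
pose N n := fat_cover (st n.+1).1 (st n.+1).2.
have mN n : measurable (N n) by exact: measurable_fat_cover.
have mbox : measurable (box a0) by exact: measurable_box.
pose E := (\bigcap_n N n) `&` box a0.
have mE : measurable E by apply: measurableI => //; exact: bigcapT_measurable.
have k0 n : 0 < (st n).2 by have [] := vst n.
have boxE : box a0 = `[a0.1 - 2, a0.1 + 2] `*` `[a0.2 - 2, a0.2 + 2].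
  apply/seteqP; split=> p; rewrite /box/= !in_itv/= !ler_norml.
    by move=> [/andP[? ?] /andP[? ?]]; split; apply/andP; split; lra.
  by move=> [/andP[? ?] /andP[? ?]]; split; apply/andP; split; lra.
have cbox : compact (box a0).
  by rewrite boxE; apply: compact_setX; exact: segment_compact.
exists E; split=> //.
- apply: subclosed_compact cbox _; last by move=> p [].
  apply: closedI; first by apply: closed_bigI => n _; exact: closed_fat_cover.
  apply: closedI; apply: closed_le_fun => p; apply: cvg_norm; apply: cvgB.
  + exact: cvg_fst.
  + exact: cvg_cst.
  + exact: cvg_snd.
  + exact: cvg_cst.
- have lamE n : (lam E <= (n.+1%:R^-1)%:E)%E.
    apply: (@le_trans _ _ (lam (N n `&` box a0))).
      apply: le_measure; rewrite ?inE//; first exact: (measurableI _ _ (mN n) mbox).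
      by move=> p [Np bp]; split=> //; exact: Np.
    by rewrite -volE// lee_fin; exact: volst.
  apply/eqP; rewrite eq_le measure_ge0 andbT.
  apply/lee_addgt0Pr => e e0; rewrite add0e.
  have := lamE (Num.truncn e^-1); move/le_trans; apply; rewrite lee_fin.
  by rewrite invf_ple ?posrE ?ltr0n//; exact/ltW/truncnS_gt.
move=> m m1.
have m12 : -1 <= m <= 1 by rewrite -ler_norml.
(* Outside the relevant case the successor is a dummy, so that choice gives a total function. *)
have nxt (x : nat * piece) : exists t, x.2 \in (st x.1).1 -> slopes x.2 m ->
    [/\ t \in (st x.1.+1).1, near_pt ((st x.1).2 / 2) x.2.1 t.1 & slopes t m].
  have [xs|nxs] := pselect (x.2 \in (st x.1).1 /\ slopes x.2 m).
    by have [_ /(_ _ _ xs.1 xs.2)[t tP]] := rst x.1; exists t.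
  by exists x.2 => ? ?; exfalso; exact: nxs.
have [G GP] := choice nxt.
pose tt := nat_rect (fun=> piece) (a0, (-1, 2)) (fun n t => G (n, t)).
have ttP n : tt n \in (st n).1 /\ slopes (tt n) m.
  elim: n => [|n [IH1 IH2]]; last by have [] := GP (n, tt n) IH1 IH2.
  rewrite st0 mem_head; split=> //=; apply/andP; split=> /=; lra.
(* Halving the radius gives moves bounded by differences of radii, as [trapped_limit] requires. *)
have ttN n : near_pt ((st n).2 - (st n.+1).2) (tt n).1 (tt n.+1).1.
  have [tn sn] := ttP n; have [_ [near1 near2] _] := GP (n, tt n) tn sn.
  have := kst n => ?; split.
    by apply: le_trans near1 _ => /=; lra.
  by apply: le_trans near2 _ => /=; lra.
have [l1 l1P] := @trapped_limit (fun n => (tt n).1.1) (fun n => (st n).2)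
  (fun n => (ttN n).1) (fun n => ltW (k0 n)).
have [l2 l2P] := @trapped_limit (fun n => (tt n).1.2) (fun n => (st n).2)
  (fun n => (ttN n).2) (fun n => ltW (k0 n)).
have kn n : (st n).2 <= n.+1%:R^-1.
  elim: n => [|n IH]; first by rewrite st0 invr1/=; lra.
  apply: (le_trans (kst n)); apply: (le_trans (ler_wpM2r _ IH)) => //.
  have n2 : (n.+2 <= n.+1 * 2)%N by rewrite muln2 -addnn addSnnS leq_addl.
  by rewrite -invfM -natrM lef_pV2 ?posrE ?ltr0n ?muln_gt0// ler_nat.
exists (l1, l2).
  apply: Acl => r r0; pose n := Num.truncn r^-1.
  have nr : (st n).2 <= r.
    apply: (le_trans (kn n)).
    by rewrite invf_ple ?posrE ?ltr0n//; exact/ltW/truncnS_gt.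
  exists (tt n).1; first by have [_] := vst n; apply; exact: (ttP n).1.
  apply: near_ptC; split=> /=; first exact: le_trans (l1P n) nr.
  exact: le_trans (l2P n) nr.
move=> u u12; split=> [n _|].
  have [tn sn] := ttP n.+1; apply: (sub_fat_cover tn sn).
  have near : near_pt (st n.+1).2 (tt n.+1).1 (l1, l2).
    by split; [exact: (l1P n.+1)|exact: (l2P n.+1)].
  by apply: (mem_fat m1 sn near) => /=; ring.
(* The center is within 1/2 of [a0] in each coordinate and the segment extends at most 1/2 further,
   so it stays in the box. *)
have := l1P 0%N; have := l2P 0%N; rewrite st0 /= => l20 l10.
have um : `|u * m| <= 2^-1 by rewrite normrM -[leRHS]mulr1 ler_pM.
split=> /=.
  rewrite -addrA addrC -addrA; apply: (le_trans (ler_normD _ _)).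
  by rewrite [X in _ + `|X|]addrC; lra.
rewrite -addrA addrC -addrA; apply: (le_trans (ler_normD _ _)).
by rewrite [X in _ + `|X|]addrC; lra.
Qed.

End construction.

(** * From bounded slopes to all directions *)

Section main.
Context {R : realType}.
Implicit Types (a b e p : R * R).

Lemma perfect_near (A : set (R * R)) a r : perfect_set A -> A a -> 0 < r ->
  exists b, [/\ A b, a != b & near_pt r a b].
Proof.
move=> [_ Al] Aa r0; have : limit_point A a by rewrite Al.
move=> /(_ (ball a r)) [|b [ba Ab [ab1 ab2]]]; first exact: nbhsx_ballx.
exists b; split=> //; first by rewrite eq_sym.
by split; rewrite distrC ltW.
Qed.

Lemma closed_near (A : set (R * R)) a : closed A ->
  (forall r, 0 < r -> exists2 b, A b & near_pt r a b) -> A a.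
Proof.
move=> clA nA; apply: clA => U /nbhs_ballP[r /= r0 rU].
have [|b Ab [ab1 ab2]] := nA (r / 2); first by rewrite divr_gt0.
by exists b; split=> //; apply: rU; split; rewrite /ball/= distrC; lra.
Qed.

Lemma compact_swap_set (E : set (R * R)) : compact E -> compact (swap_set E).
Proof.
move=> cE; rewrite (_ : swap_set E = (fun p => (p.2, p.1)) @` E); last first.
  apply/seteqP; split=> [[x y] Exy|_ [[x y] Exy <-]] //.
  by exists (y, x).
apply: continuous_compact => //; apply: continuous_subspaceT => p.
exact: swap_continuous.
Qed.

(** The parameter is [u = t * e.1]. Here [e.1] is nonzero, as otherwise both coordinates would
    vanish, and [|e.1| <= 1] keeps [u] in range. *)
Lemma unit_segment_sub (E : set (R * R)) a e : unit_circle R e -> `|e.2| <= `|e.1| ->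
  (forall u, `|u| <= 2^-1 -> E (a.1 + u, a.2 + u * (e.2 / e.1))) ->
  unit_segment a e `<=` E.
Proof.
rewrite /unit_circle/= => e1 le21 Eu _ [t /= + <-].
rewrite in_itv/= -ler_norml => t12.
have e10 : e.1 != 0.
  apply/eqP => e10; move: le21 e1; rewrite e10 normr0 normr_le0 => /eqP ->.
  by rewrite expr0n addr0 => /esym/eqP; rewrite oner_eq0.
have e11 : `|e.1| <= 1.
  by rewrite -(@ler_pXn2r _ 2)// ?nnegrE// expr1n real_normK ?num_real//;
    have := sqr_ge0 e.2; lra.
have := Eu (t * e.1).
rewrite (_ : t * e.1 * (e.2 / e.1) = t * e.2); last by field.
apply.
by rewrite normrM -[leRHS]mulr1 ler_pM.
Qed.

End main.

Unset Implicit Arguments.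

Theorem theorem1p3 (R : realType) (A : set (R * R)) :
  A !=set0 -> perfect_set A ->
  exists E : set (R * R),
    [/\ compact E,
        lebesgue_measure2 E = 0%E
      & forall e : R * R, unit_circle R e ->
          exists2 a, A a & unit_segment a e `<=` E].
Proof.
move=> [a0 Aa0] Ap.
have Acc a r : A a -> 0 < r -> exists b, [/\ A b, a != b & near_pt r a b].
  exact: perfect_near.
have Acl a : (forall r, 0 < r -> exists2 b, A b & near_pt r a b) -> A a.
  by apply: closed_near; case: Ap.
have [E [mE cE E0 EP]] := bounded_slopes Acc Acl Aa0.
(* Steep directions are handled by the same construction for the reflected set [swap_set A]. *)
have sAcc a r : swap_set A a -> 0 < r ->
    exists b, [/\ swap_set A b, a != b & near_pt r a b].
  case: a => x y Ayx r0; have [b [Ab ab [? ?]]] := Acc _ _ Ayx r0.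
  exists (b.2, b.1); split=> //.
    by rewrite /swap_set/= -surjective_pairing.
  by apply: contra ab => /eqP[-> ->]; rewrite -surjective_pairing.
have sAcl a : (forall r, 0 < r -> exists2 b, swap_set A b & near_pt r a b) ->
    swap_set A a.
  case: a => x y nA; apply: Acl => r /nA[[u v] Avu [? ?]].
  by exists (v, u).
have sAa0 : swap_set A (a0.2, a0.1) by rewrite /swap_set/= -surjective_pairing.
have [F [mF cF F0 FP]] := bounded_slopes sAcc sAcl sAa0.
have msF := measurable_swap_set mF.
exists (E `|` swap_set F); split.
- by apply: compactU => //; exact: compact_swap_set.
- apply/eqP; rewrite eq_le measure_ge0 andbT.
  have lamU : (lebesgue_measure2 (E `|` swap_set F) <=
      lebesgue_measure2 E + lebesgue_measure2 (swap_set F))%E by exact: measureU2.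
  by apply: le_trans lamU _; rewrite E0 add0e area_swap// F0.
move=> [e1 e2] ec.
have [le21|/ltW le12] := leP `|e2| `|e1|.
  have m1 : `|e2 / e1| <= 1.
    (* For [e1 = 0] the quotient is 0 by the convention for division. *)
    have [->|e10] := eqVneq e1 0; first by rewrite invr0 mulr0 normr0.
    by rewrite normrM normfV ler_pdivrMr ?normr_gt0// mul1r.
  have [a Aa aE] := EP _ m1; exists a => //.
  by apply: subset_trans (@subsetUl _ _ _); exact: unit_segment_sub.
have m1 : `|e1 / e2| <= 1.
  have [->|e20] := eqVneq e2 0; first by rewrite invr0 mulr0 normr0.
  by rewrite normrM normfV ler_pdivrMr ?normr_gt0// mul1r.
have [[x y] Aa aF] := FP _ m1; exists (y, x) => //.
apply: subset_trans (@subsetUr _ _ _) => _ [t t12 <-].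
have sc : unit_circle R (e2, e1) by move: ec; rewrite /unit_circle/= addrC.
by apply: (unit_segment_sub sc le12 aF); exists t.
Qed.
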